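(* Let $G$ be a weighted graph. There exists a unique group homomorphism $h : J(G) \to \operatorname{Pic}^0(G)$ such that the square with top arrow $d^* : C_1(G,\mathbb{Z}) \to \operatorname{Div}^0(G)$, left vertical arrow $C_1(G,\mathbb{Z}) \to J(G)$, $\alpha \mapsto [\int_\alpha]$, right vertical arrow the quotient map $\operatorname{Div}^0(G) \to \operatorname{Pic}^0(G)$, and bottom arrow $h$ commutes; that is, $h([\int_\alpha]) = [d^*\alpha]$ for every $\alpha \in C_1(G,\mathbb{Z})$. Moreover, $h : J(G) \to \operatorname{Pic}^0(G)$ is an isomorphism.
   Context: A weighted graph $G$ is a finite connected multigraph (loops and multiple edges allowed) with nonempty finite vertex set $V(G)$, finite edge set $E(G)$, a length function $\ell : E(G) \to \mathbb{R}_{>0}$, and a fixed orientation: each edge $e$ has a tail $e^-$ and a head $e^+$ in $V(G)$. For $A \in \{\mathbb{Z},\mathbb{R}\}$, $C_0(G,A)$ and $C_1(G,A)$ are the free $A$-modules on $V(G)$ and $E(G)$; their elements are identified with functions $V(G) \to A$ and $E(G) \to A$. Define $d : C_0(G,\mathbb{R}) \to C_1(G,\mathbb{R})$ by $(df)(e) = \frac{f(e^+)-f(e^-)}{\ell(e)}$ and $d^* : C_1(G,\mathbb{R}) \to C_0(G,\mathbb{R})$ by $(d^*\alpha)(x) = \sum_{e : e^+ = x}\alpha(e) - \sum_{e : e^-=x}\alpha(e)$. Put $H_1(G,\mathbb{R}) = \ker(d^* )$, $H_1(G,\mathbb{Z}) = \ker(d^* ) \cap C_1(G,\mathbb{Z})$,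 $\operatorname{im}(d)_{\mathbb{Z}} = \operatorname{im}(d)\cap C_1(G,\mathbb{Z})$. A 1-form is an element $\omega = \sum_e \omega_e\, de$ of the real vector space with formal basis $\{de : e \in E(G)\}$; it is harmonic if $\sum_{e: e^+=x}\omega_e = \sum_{e : e^-=x}\omega_e$ for all $x \in V(G)$. $\Omega(G)$ is the space of harmonic 1-forms. Integration is the bilinear pairing $\Omega(G)\times C_1(G,\mathbb{R}) \to \mathbb{R}$, $(\omega,\alpha)\mapsto \int_\alpha \omega$, determined by $\int_{e'} de = \ell(e)$ if $e=e'$ and $0$ otherwise; so each $\alpha\in C_1(G,\mathbb{R})$ gives a functional $\int_\alpha \in \Omega(G)^*$. Put $\Omega(G)^\sharp = \{\int_\alpha : \alpha \in C_1(G,\mathbb{Z})\}$. The map $\alpha \mapsto \int_\alpha$ is injective on $H_1(G,\mathbb{Z})$, which is thereby viewed as a subgroup of $\Omega(G)^\sharp$. The Jacobian is $J(G) = \Omega(G)^\sharp / H_1(G,\mathbb{Z})$. $\operatorname{Div}(G) = C_0(G,\mathbb{Z})$, $\deg(D) = \sum_x D(x)$, $\operatorname{Div}^0(G) = \{D \in \operatorname{Div}(G) : \deg D = 0\}$, $\operatorname{Prin}(G) = d^*(\operatorname{im}(d)_{\mathbb{Z}}) \subseteq \operatorname{Div}^0(G)$, and $\operatorname{Pic}^0(G) = \operatorname{Div}^0(G)/\operatorname{Prin}(G)$. *)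

(* Defs.v *)
From HB Require Import structures.
From mathcomp Require Import all_boot all_order all_algebra.
From mathcomp Require Import boolp reals.

Set Implicit Arguments.
Unset Strict Implicit.
Unset Printing Implicit Defensive.

Import Order.TTheory GRing.Theory Num.Theory.
Local Open Scope ring_scope.

Definition adjacent (V E : finType) (tail head : E -> V) : rel V :=
  fun x y => [exists e, (tail e == x) && (head e == y)
                     || (tail e == y) && (head e == x)].

Record weighted_graph (R : realType) := WeightedGraph {
  vertex : finType;
  edge : finType;
  length : edge -> R;
  tail : edge -> vertex;
  head : edge -> vertex;
  length_gt0 : forall e, 0 < length e;
  vertex_neq0 : (0 < #|vertex|)%N;
  connected : forall x y, connect (adjacent tail head) x y
}.

Notation C0 G A := {ffun vertex G -> A}.
Notation C1 G A := {ffun edge G -> A}.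

Section Chains.
Variables (R : realType) (G : weighted_graph R).

Definition d (f : C0 G R) : C1 G R :=
  [ffun e => (f (head e) - f (tail e)) / length e].

Definition dstar (A : zmodType) (a : C1 G A) : C0 G A :=
  [ffun x => \sum_(e | head e == x) a e - \sum_(e | tail e == x) a e].

Fact dstar_is_zmod_morphism (A : zmodType) : zmod_morphism (@dstar A).
Proof.
move=> a b; apply/ffunP=> x; rewrite !ffunE.
under eq_bigr do rewrite !ffunE.
under [X in _ - X = _]eq_bigr do rewrite !ffunE.
by rewrite !sumrB !opprB [LHS]addrACA [RHS]addrACA; congr (_ + _); rewrite addrC.
Qed.

HB.instance Definition _ (A : zmodType) :=
  GRing.isZmodMorphism.Build (C1 G A) (C0 G A) (@dstar A)
    (@dstar_is_zmod_morphism A).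

Fact dstar_is_scalable : scalable (@dstar R^o).
Proof.
move=> k a; apply/ffunP=> x; rewrite !ffunE scalerBr !scaler_sumr.
by congr (_ - _); apply: eq_bigr => e _; rewrite ffunE.
Qed.

HB.instance Definition _ :=
  GRing.isScalable.Build R (C1 G R^o) (C0 G R^o) *:%R (@dstar R^o)
    dstar_is_scalable.

Definition C1_real (a : C1 G int) : C1 G R := [ffun e => (a e)%:~R].

Definition im_d_int (a : C1 G int) : Prop :=
  exists f : C0 G R, C1_real a = d f.

Definition H1_int (a : C1 G int) : Prop := dstar a = 0.

Fact C1_real_is_zmod_morphism : zmod_morphism C1_real.
Proof. by move=> a b; apply/ffunP=> e; rewrite !ffunE rmorphB. Qed.

HB.instance Definition _ :=
  GRing.isZmodMorphism.Build (C1 G int) (C1 G R) C1_real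
    C1_real_is_zmod_morphism.

Fact d_is_zmod_morphism : zmod_morphism d.
Proof.
move=> f g; apply/ffunP=> e; rewrite !ffunE -mulrBl; congr (_ / _).
by rewrite !opprB [LHS]addrACA [RHS]addrACA; congr (_ + _); rewrite addrC.
Qed.

HB.instance Definition _ :=
  GRing.isZmodMorphism.Build (C0 G R) (C1 G R) d d_is_zmod_morphism.

End Chains.

Section Jacobian.
Variables (R : realType) (G : weighted_graph R).

(* The 1-form \sum_e w_e de is represented by its coefficient family w. *)
Notation one_form := (C1 G R^o).

(* The harmonicity condition on w reads dstar w = 0; see harmonicP. *)
Definition harmonic : {vspace one_form} := lker (linfun (@dstar R G R^o)).

Lemma harmonicP (w : one_form) :
  reflect (forall x, \sum_(e | head e == x) w e = \sum_(e | tail e == x) w e)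
          (w \in harmonic).
Proof.
rewrite memv_ker lfunE /=; apply: (iffP eqP) => [w0 x | w0].
  by apply/eqP; rewrite -subr_eq0; move/ffunP/(_ x): w0; rewrite !ffunE => ->.
by apply/ffunP=> x; rewrite !ffunE w0 subrr.
Qed.

Definition Omega := subvs_of harmonic.

Definition integral (w : one_form) (a : C1 G R) : R :=
  \sum_e w e * a e * length e.

Definition integral_over (a : C1 G R) : Omega -> R^o :=
  fun w => integral (vsval w) a.

Fact integral_over_is_linear (a : C1 G R) : linear (integral_over a).
Proof.
move=> k u v; rewrite /integral_over /integral scaler_sumr -big_split.
apply: eq_bigr => e _ /=; rewrite !ffunE !mulrDl.
by congr (_ + _); rewrite /GRing.scale /= !mulrA.
Qed.

HB.instance Definition _ (a : C1 G R) :=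
  GRing.isLinear.Build R Omega R^o *:%R (integral_over a)
    (integral_over_is_linear a).

Definition integral_functional (a : C1 G R) : 'Hom(Omega, R^o) :=
  linfun (integral_over a).

Lemma integral_functionalE a w :
  integral_functional a w = integral (vsval w) a.
Proof. by rewrite lfunE. Qed.

Fact integral_functional_is_zmod_morphism : zmod_morphism integral_functional.
Proof.
move=> a b; apply/lfunP=> w.
rewrite add_lfunE opp_lfunE !integral_functionalE /integral -sumrB.
by apply: eq_bigr => e _; rewrite !ffunE mulrBr mulrBl.
Qed.

HB.instance Definition _ :=
  GRing.isZmodMorphism.Build (C1 G R) 'Hom(Omega, R^o) integral_functional
    integral_functional_is_zmod_morphism.

Definition integral_lattice : {pred 'Hom(Omega, R^o)} :=
  fun phi => `[< exists a : C1 G int, phi = integral_functional (C1_real a) >].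

Fact integral_lattice_zmod_closed : zmod_closed integral_lattice.
Proof.
split=> [|_ _ /asboolP[a ->] /asboolP[b ->]]; apply/asboolP.
  by exists 0; rewrite !raddf0.
by exists (a - b); rewrite !raddfB.
Qed.

HB.instance Definition _ :=
  GRing.isZmodClosed.Build 'Hom(Omega, R^o) integral_lattice
    integral_lattice_zmod_closed.

Record Omega_sharp := OmegaSharp {
  sharp_val :> 'Hom(Omega, R^o);
  _ : sharp_val \in integral_lattice
}.

HB.instance Definition _ := [isSub for sharp_val].
HB.instance Definition _ := [Choice of Omega_sharp by <:].
HB.instance Definition _ := [SubChoice_isSubZmodule of Omega_sharp by <:].

Fact mem_integral_lattice (a : C1 G int) :
  integral_functional (C1_real a) \in integral_lattice.
Proof. by apply/asboolP; exists a. Qed.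

Definition integral_sharp (a : C1 G int) : Omega_sharp :=
  OmegaSharp (mem_integral_lattice a).

Fact integral_sharp_is_zmod_morphism : zmod_morphism integral_sharp.
Proof. by move=> a b; apply: val_inj; rewrite /= !raddfB. Qed.

HB.instance Definition _ :=
  GRing.isZmodMorphism.Build (C1 G int) Omega_sharp integral_sharp
    integral_sharp_is_zmod_morphism.

Lemma integral_sharp_inj (a b : C1 G int) : H1_int a -> H1_int b ->
  integral_sharp a = integral_sharp b -> a = b.
Proof.
move=> a0 b0 /eqP; rewrite -subr_eq0 -raddfB => /eqP/(congr1 val)/=.
have {a0 b0} : H1_int (a - b) by rewrite /H1_int raddfB /= a0 b0 subr0.
move=> c0 intc0; apply: subr0_eq; move: (a - b) c0 intc0 => c c0 intc0.
pose w : one_form := C1_real c.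
have hw : w \in harmonic.
  apply/harmonicP=> x; under eq_bigr do rewrite ffunE.
  under [RHS]eq_bigr do rewrite ffunE.
  rewrite -!rmorph_sum; congr (_%:~R); apply/eqP; rewrite -subr_eq0.
  by move/ffunP/(_ x): c0; rewrite !ffunE => ->.
have := integral_functionalE (C1_real c) (vsproj harmonic w).
rewrite intc0 zero_lfunE vsprojK // => /esym/eqP.
rewrite psumr_eq0 => [|e _]; last first.
  by rewrite mulr_ge0 ?(ltW (length_gt0 e)) // !ffunE -expr2 sqr_ge0.
move=> /allP c_eq0; apply/ffunP=> e; have := c_eq0 e (mem_index_enum e).
by rewrite !ffunE /= !mulf_eq0 (gt_eqF (length_gt0 e)) orbF orbb intr_eq0
  => /eqP.
Qed.

(* H_1(G, Z) viewed inside Omega^#, i.e. its image under a |-> \int_a. *)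
Definition H1_sharp : {pred Omega_sharp} :=
  fun phi => `[< exists2 a : C1 G int, H1_int a & phi = integral_sharp a >].

Fact H1_sharp_zmod_closed : zmod_closed H1_sharp.
Proof.
split=> [|_ _ /asboolP[a a0 ->] /asboolP[b b0 ->]]; apply/asboolP.
  by exists 0; rewrite /H1_int raddf0.
by exists (a - b); rewrite ?raddfB // /H1_int raddfB /= a0 b0 subr0.
Qed.

HB.instance Definition _ :=
  GRing.isZmodClosed.Build Omega_sharp H1_sharp H1_sharp_zmod_closed.

Definition Jacobian : zmodType := Quotient.quot H1_sharp.

Definition Jacobian_class (phi : Omega_sharp) : Jacobian :=
  (\pi_(Quotient.quot H1_sharp) phi)%qT.

End Jacobian.

Section Picard.
Variables (R : realType) (G : weighted_graph R).

Notation Div := (C0 G int).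

Definition deg (D : Div) : int := \sum_x D x.

Definition degree0 : {pred Div} := fun D => deg D == 0.

Fact degree0_zmod_closed : zmod_closed degree0.
Proof.
split=> [|D D' /eqP D0 /eqP D'0]; apply/eqP.
  by rewrite /deg big1 // => x _; rewrite ffunE.
transitivity (deg D - deg D'); last by rewrite D0 D'0 subrr.
by rewrite -sumrB; apply: eq_bigr => x _; rewrite !ffunE.
Qed.

HB.instance Definition _ :=
  GRing.isZmodClosed.Build Div degree0 degree0_zmod_closed.

Record Div0 := MkDiv0 { div0_val :> Div; _ : div0_val \in degree0 }.

HB.instance Definition _ := [isSub for div0_val].
HB.instance Definition _ := [Choice of Div0 by <:].
HB.instance Definition _ := [SubChoice_isSubZmodule of Div0 by <:].

Fact dstar_degree0 (a : C1 G int) : dstar a \in degree0.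
Proof.
apply/eqP; rewrite /deg; under eq_bigr do rewrite ffunE.
have fiber_sum (f : edge G -> vertex G) :
    \sum_x \sum_(e | f e == x) a e = \sum_e a e.
  by rewrite [RHS](partition_big f xpredT).
by rewrite sumrB !fiber_sum subrr.
Qed.

Definition dstar0 (a : C1 G int) : Div0 := MkDiv0 (dstar_degree0 a).

Fact dstar0_is_zmod_morphism : zmod_morphism dstar0.
Proof. by move=> a b; apply: val_inj; rewrite /= raddfB. Qed.

HB.instance Definition _ :=
  GRing.isZmodMorphism.Build (C1 G int) Div0 dstar0 dstar0_is_zmod_morphism.

Definition Prin : {pred Div0} :=
  fun D => `[< exists2 a : C1 G int, im_d_int a & D = dstar0 a >].

Fact Prin_zmod_closed : zmod_closed Prin.
Proof.
split=> [|_ _ /asboolP[a [f fa] ->] /asboolP[b [g gb] ->]]; apply/asboolP.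
  by exists 0; [exists 0|]; rewrite !raddf0.
by exists (a - b); [exists (f - g); rewrite !raddfB /= fa gb|rewrite raddfB].
Qed.

HB.instance Definition _ :=
  GRing.isZmodClosed.Build Div0 Prin Prin_zmod_closed.

Definition Pic0 : zmodType := Quotient.quot Prin.

Definition Pic0_class (D : Div0) : Pic0 := (\pi_(Quotient.quot Prin) D)%qT.

End Picard.

(* Main.v *)
Require Import Defs.
From HB Require Import structures.
From mathcomp Require Import all_boot all_order all_algebra.
From mathcomp Require Import boolp reals.
Import Order.TTheory GRing.Theory.
(* [head] and [tail] are those of a graph, not those of a sequence. *)
Import Defs.
Set Implicit Arguments.
Unset Strict Implicit.
Unset Printing Implicit Defensive.
Local Open Scope ring_scope.

(** The square defines h as soon as the two quotient maps C1(G,Z) -> J(G) and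
    C1(G,Z) -> Div0(G) -> Pic0(G) have the same kernel, and h is then an
    isomorphism as soon as both are onto.  The first map is onto by the
    definition of J(G), the second because G is connected: a chain carried by a
    walk from x to y has boundary y - x, and such differences generate Div0(G)
    ([dstar0_surj]).

    Both kernels equal H1(G,Z) + im(d)_Z.  For Pic0(G) this is formal: d^*a is
    principal iff d^*a = d^*b for some b in im(d)_Z, that is, iff a - b lies in
    H1(G,Z).  For J(G) the same manipulation reduces it to the fact that the
    functional \int_a vanishes iff a lies in im(d) ([integral_sharp_eq0]).
    That d f integrates to zero against a harmonic form is the adjointness of d
    and d^*.  Conversely, an integral cycle is itself a harmonic form, so if
    \int_a = 0 then the 1-cochain a * length has no periods, and integrating it
    along walks issued from a base vertex gives a potential f with a = d f
    ([im_d_of_no_periods]). *)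

(** * Homomorphisms induced on quotients *)

(** Both B and C are the quotient of A by the common kernel of p and q; lifting
    along p and then applying q is independent of the lift. *)
Lemma induced_isomorphism (A B C : zmodType)
    (p : {additive A -> B}) (q : {additive A -> C}) :
  (forall b, exists a, p a = b) -> (forall c, exists a, q a = c) ->
  (forall a, p a = 0 <-> q a = 0) ->
  exists h : {additive B -> C},
    [/\ forall a, h (p a) = q a,
        forall h' : {additive B -> C}, (forall a, h' (p a) = q a) -> h' =1 h
      & bijective h].
Proof.
move=> /choice[s ps] /choice[t qt] kerpq.
have peq_qeq a a' : p a = p a' <-> q a = q a'.
  split=> /eqP; rewrite -subr_eq0 -raddfB => /eqP/kerpq/eqP;
  by rewrite raddfB subr_eq0 => /eqP.
have h_morph : zmod_morphism (q \o s).
  by move=> b b'; rewrite /= -raddfB; apply/peq_qeq; rewrite raddfB !ps.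
pose hM := GRing.isZmodMorphism.Build B C (q \o s) h_morph.
pose h : {additive B -> C} := HB.pack (q \o s) hM.
have hp a : h (p a) = q a by apply/peq_qeq; rewrite ps.
exists h; split=> // [h' h'p b|].
  by rewrite -(ps b) h'p hp.
exists (p \o t) => [b|c]; last by rewrite [LHS]hp qt.
by rewrite -[RHS]ps; apply/peq_qeq; rewrite qt.
Qed.

(** * Chains of walks *)

Section Walks.
Variables (R : realType) (G : weighted_graph R).
Implicit Types (x y : vertex G) (e : edge G).

Definition point x : C0 G int := [ffun y => (y == x)%:R].
Definition edge_chain e : C1 G int := [ffun e' => (e' == e)%:R].

Lemma dstar_edge_chain e :
  dstar (edge_chain e) = point (head e) - point (tail e).
Proof.
apply/ffunP=> x; rewrite !ffunE.
have fiber (g : edge G -> vertex G) :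
    \sum_(e' | g e' == x) edge_chain e e' = (x == g e)%:R.
  rewrite (eq_bigr (fun e' => (e' == e)%:R)) => [|e' _]; last by rewrite ffunE.
  rewrite big_mkcond (bigD1 e) //= eqxx big1 => [|e' /negPf->].
    by rewrite addr0 eq_sym; case: eqP.
  by case: ifP.
by rewrite !fiber.
Qed.

Lemma walk_chain x y : exists a : C1 G int, dstar a = point y - point x.
Proof.
have /connectP[s] := connected x y.
elim: s x => [|z s IHs] x /=.
  by move=> _ ->; exists 0; rewrite raddf0 subrr.
case/andP=> /existsP[e xz] /IHs{}IHs /IHs[a da].
have [b db] : exists b : C1 G int, dstar b = point z - point x.
  (* The walk may cross e against its orientation. *)
  case/orP: xz => /andP[/eqP<- /eqP<-].
    by exists (edge_chain e); apply: dstar_edge_chain.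
  by exists (- edge_chain e); rewrite raddfN /= dstar_edge_chain opprB.
by exists (a + b); rewrite raddfD /= da db addrA subrK.
Qed.

(** With chains p x from a base vertex x0 to each x, the combination of the p x
    with coefficients D x has boundary D - (deg D) x0, which is D. *)
Lemma dstar0_surj (D : Div0 G) : exists a : C1 G int, dstar0 a = D.
Proof.
have /card_gt0P[x0 _] := vertex_neq0 G.
have [p dp] := choice (walk_chain x0).
exists (\sum_x p x *~ D x); apply/val_inj/ffunP=> y /=.
rewrite raddf_sum sum_ffunE /=.
transitivity (\sum_x (D x * (y == x)%:R - D x * (y == x0)%:R)).
  apply: eq_bigr => x _; rewrite raddfMz /= dp.
  by rewrite ffunMzE !ffunE -mulrzr mulrC mulrBr intz.
have D0 : \sum_x D x = 0 by case: D => D D0 /=; exact/eqP.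
rewrite sumrB -mulr_suml D0 mul0r subr0 (bigD1 y) //= eqxx mulr1.
by rewrite big1 ?addr0 // => x /negPf; rewrite eq_sym => ->; rewrite mulr0.
Qed.

End Walks.

(** * Integrals over exact chains *)

Section Periods.
Variables (R : realType) (G : weighted_graph R).

(** Adjointness of d and d^* for the length-weighted pairing. *)
Lemma integral_d (w : C1 G R) (f : C0 G R) :
  integral w (d f) = \sum_x dstar w x * f x.
Proof.
have fiber (g : edge G -> vertex G) :
    \sum_x (\sum_(e | g e == x) w e) * f x = \sum_e w e * f (g e).
  rewrite [RHS](partition_big g xpredT) //=; apply: eq_bigr => x _.
  by rewrite mulr_suml; apply: eq_bigr => e /eqP->.
under [RHS]eq_bigr do rewrite ffunE mulrBl.
rewrite sumrB !fiber -sumrB; apply: eq_bigr => e _.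
by rewrite ffunE -mulrA divfK ?mulrBr // gt_eqF ?length_gt0.
Qed.

Lemma integralBl (a : C1 G R) : {morph (@integral R G)^~ a : v w / v - w}.
Proof.
by move=> v w; rewrite /integral -sumrB; apply: eq_bigr => e _;
  rewrite !ffunE !mulrBl.
Qed.

Lemma integral_edge_chain e (a : C1 G R) :
  integral (C1_real (edge_chain e)) a = a e * length e.
Proof.
rewrite /integral (bigD1 e) //= !ffunE eqxx mul1r big1 ?addr0 // => e' /negPf ne.
by rewrite !ffunE ne !mul0r.
Qed.

(** The potential at x is the integral along a walk from a base vertex to x.
    Integral cycles suffice to test the periods because comparing the
    potentials at both ends of an edge only involves the cycle formed by that
    edge and the two walks. *)
Lemma im_d_of_no_periods (a : C1 G R) :
  (forall c : C1 G int, H1_int c -> integral (C1_real c) a = 0) ->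
  exists f : C0 G R, a = d f.
Proof.
move=> periods0.
have /card_gt0P[x0 _] := vertex_neq0 G.
have [p dp] := choice (walk_chain x0).
exists [ffun x => integral (C1_real (p x)) a]; apply/ffunP=> e.
(* The closed walk from x0 to tail e, across e to head e, and back to x0. *)
have cycle : H1_int (edge_chain e - (p (head e) - p (tail e))).
  rewrite /H1_int !(raddfB (@dstar R G int)) /= dstar_edge_chain !dp.
  by rewrite [- (point (tail e) - _)]opprB subrKA subrr.
have := periods0 _ cycle.
rewrite !(raddfB (@C1_real R G)) !integralBl integral_edge_chain => /eqP; rewrite subr_eq0.
by rewrite !ffunE => /eqP<-; rewrite mulfK ?gt_eqF ?length_gt0.
Qed.

Lemma C1_real_harmonic (c : C1 G int) : H1_int c -> C1_real c \in harmonic G.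
Proof.
move=> c0; apply/harmonicP=> x.
under eq_bigr do rewrite ffunE; under [RHS]eq_bigr do rewrite ffunE.
rewrite -!rmorph_sum; congr (_%:~R); apply/eqP; rewrite -subr_eq0.
by move/ffunP/(_ x): c0; rewrite !ffunE => ->.
Qed.

(** An integral cycle serves both as a chain and as a harmonic form, and the
    pairing of forms and chains is symmetric: vanishing of \int_a on harmonic
    forms therefore gives vanishing of the periods of a. *)
Lemma integral_sharp_eq0 (a : C1 G int) : integral_sharp a = 0 <-> im_d_int a.
Proof.
split=> [/(congr1 val)/= int0|[f af]].
  apply: im_d_of_no_periods => c /C1_real_harmonic hc.
  have := integral_functionalE (C1_real a) (vsproj (harmonic G) (C1_real c)).
  by rewrite int0 zero_lfunE vsprojK.
apply/val_inj/lfunP=> w; rewrite zero_lfunE /= integral_functionalE af.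
have dw0 : dstar (vsval w : C1 G R) = 0.
  by have := subvsP w; rewrite memv_ker lfunE => /eqP.
by rewrite integral_d dw0 big1 // => x _; rewrite ffunE mul0r.
Qed.

End Periods.

(** * The two quotient maps *)
Section Classes.
Variables (R : realType) (G : weighted_graph R).

Fact Jacobian_class_is_zmod_morphism : zmod_morphism (@Jacobian_class R G).
Proof. by move=> x y; rewrite /Jacobian_class raddfB. Qed.

HB.instance Definition _ :=
  GRing.isZmodMorphism.Build (Omega_sharp G) (Jacobian G) (@Jacobian_class R G)
    Jacobian_class_is_zmod_morphism.

Fact Pic0_class_is_zmod_morphism : zmod_morphism (@Pic0_class R G).
Proof. by move=> x y; rewrite /Pic0_class raddfB. Qed.

HB.instance Definition _ :=
  GRing.isZmodMorphism.Build (Div0 G) (Pic0 G) (@Pic0_class R G)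
    Pic0_class_is_zmod_morphism.

Lemma quot_pi_eq0 (M : zmodType) (I : zmodClosed M) (x : M) :
  (\pi_(Quotient.quot I) x)%qT = 0 <-> x \in I.
Proof.
rewrite -[x in X in _ <-> X]subr0 Quotient.idealrBE.
rewrite -(raddf0 (\pi_(Quotient.quot I))%qT).
by split=> [->|/eqP].
Qed.

Lemma Jacobian_class_eq0 (a : C1 G int) :
  Jacobian_class (integral_sharp a) = 0 <->
  exists2 b : C1 G int, im_d_int b & H1_int (a - b).
Proof.
split=> [/quot_pi_eq0/asboolP[c c0 ac]|[b db ab0]].
  exists (a - c); last by rewrite subKr.
  by apply/integral_sharp_eq0; rewrite raddfB /= ac subrr.
apply/quot_pi_eq0/asboolP; exists (a - b) => //.
by rewrite raddfB /= (integral_sharp_eq0 b).2 // subr0.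
Qed.

Lemma Pic0_class_eq0 (a : C1 G int) :
  Pic0_class (dstar0 a) = 0 <->
  exists2 b : C1 G int, im_d_int b & H1_int (a - b).
Proof.
split=> [/quot_pi_eq0/asboolP[b db ab]|[b db ab0]].
  exists b => //; rewrite /H1_int raddfB /=.
  by move/(congr1 val): ab => /= ->; rewrite subrr.
apply/quot_pi_eq0/asboolP; exists b => //; apply/val_inj/eqP => /=.
by rewrite -subr_eq0 -raddfB; apply/eqP.
Qed.

Lemma Jacobian_class_integral_surj (j : Jacobian G) :
  exists a : C1 G int, Jacobian_class (integral_sharp a) = j.
Proof.
have /asboolP[a va] := valP (repr j); exists a.
by rewrite -[RHS]reprK; congr (\pi_(_) _)%qT; apply: val_inj.
Qed.

Lemma Pic0_class_dstar0_surj (c : Pic0 G) :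
  exists a : C1 G int, Pic0_class (dstar0 a) = c.
Proof.
have [a da] := dstar0_surj (repr c).
by exists a; rewrite da /Pic0_class reprK.
Qed.

End Classes.

Theorem theorem2p8 (R : realType) (G : weighted_graph R) :
  exists h : {additive Jacobian G -> Pic0 G},
    [/\ forall a : C1 G int,
          h (Jacobian_class (integral_sharp a)) = Pic0_class (dstar0 a),
        forall h' : {additive Jacobian G -> Pic0 G},
          (forall a : C1 G int,
            h' (Jacobian_class (integral_sharp a)) = Pic0_class (dstar0 a)) ->
          h' =1 h
      & bijective h].
Proof.
apply: (@induced_isomorphism _ _ _ (@Jacobian_class R G \o @integral_sharp R G)
  (@Pic0_class R G \o @dstar0 R G)).
- exact: Jacobian_class_integral_surj.
- exact: Pic0_class_dstar0_surj.
- by move=> a; rewrite /= Jacobian_class_eq0 Pic0_class_eq0.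
Qed.
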